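(* Let $\mathcal H$ be a real or complex Hilbert space and let $T$ be a positive symmetric operator defined on a linear subspace $\mathcal D$ of $\mathcal H$ (with values in $\mathcal H$). Then the following statements are equivalent: (i) $T$ can be extended to a bounded positive operator on $\mathcal H$; (ii) $\mathcal D_*(T)=\mathcal H$; (iii) there exists a constant $\gamma>0$ such that $$\|Tf\|^2\le\gamma\cdot\langle Tf,f\rangle,\qquad\forall f\in\mathcal D.$$ In any case (i.e. when these conditions hold, with $\gamma$ as in (iii)), the Krein-von Neumann extension $T_N$ of $T$ is bounded with $\|T_N\|\le\gamma$.
   Context: An operator $T:\mathcal D\to\mathcal H$ on a linear subspace $\mathcal D\subseteq\mathcal H$ (not assumed dense or closed) is positive symmetric if $\langle Tf,g\rangle=\langle f,Tg\rangle$ and $\langle Tf,f\rangle\ge0$ for all $f,g\in\mathcal D$. A bounded positive operator on $\mathcal H$ is an everywhere defined bounded self-adjoint operator with nonnegative quadratic form. Further, $$\mathcal D_*(T):=\Big\{g\in\mathcal H:\ \sup\{|\langle Th,g\rangle|^2: h\in\mathcal D,\ \langle Th,h\rangle\le1\}<+\infty\Big\}.$$ If the positive symmetric operator $T$ has a positive self-adjoint extension, its Krein-von Neumann extension $T_N$ is the smallest positive self-adjoint extension with respect to the form order ($S_1\preceq S_2$ iff $(I+S_2)^{-1}\le(I+S_1)^{-1}$). Concretely $T_N=J_T^{**}J_T^*$, where $\mathcal E_T$ is the completion of $\operatorname{ran}T$ under the (well-defined) inner product $\langle Tf,Th\rangle_{\mathcal E}:=\langle Tf,h\rangle$, and $J_T:\mathcal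 E_T\to\mathcal H$ is the densely defined closable operator with $\operatorname{dom}J_T=\operatorname{ran}T$ and $J_T(Th):=Th$. *)

(* Defs.v *)
From HB Require Import structures.
From mathcomp Require Import all_boot all_order all_algebra sesquilinear.
From mathcomp Require Import complex.
From mathcomp Require Import all_classical all_reals all_analysis.

Set Implicit Arguments.
Unset Strict Implicit.
Unset Printing Implicit Defensive.

Import Order.TTheory GRing.Theory Num.Theory.
Import numFieldNormedType.Exports.

Local Open Scope classical_set_scope.
Local Open Scope ring_scope.

Variant scalar_kind := RealScalars | ComplexScalars.

Definition scalars (R : realType) (k : scalar_kind) : numFieldType :=
  match k with
  | RealScalars => R
  | ComplexScalars => R[i]
  end.

Definition conj_scalar (R : realType) (k : scalar_kind) :
    scalars R k -> scalars R k :=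
  match k with
  | RealScalars => fun z => z
  | ComplexScalars => @conjc R
  end.

Definition re_scalar (R : realType) (k : scalar_kind) : scalars R k -> R :=
  match k with
  | RealScalars => fun z => z
  | ComplexScalars => @complex.Re R
  end.

Record hilbert_space (R : realType) (k : scalar_kind) := HilbertSpace {
  hilbert_carrier :> completeNormedModType (scalars R k);
  (* linear in the first argument, conjugate-linear in the second *)
  inner : {dot hilbert_carrier for @conj_scalar R k};
  inner_norm : forall x : hilbert_carrier, inner x x = `|x| ^+ 2 }.

Section Operators.
Context {R : realType} {k : scalar_kind} {H : hilbert_space R k}.

Local Notation "'[ x , y ]" := (inner H x y) : ring_scope.

(* MathComp-Analysis norms take their values in the scalar field; [hnorm]
   reads the norm, which is real, in R. *)
Definition hnorm (x : H) : R := re_scalar `|x|.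

(* A linear operator defined on a linear subspace [dom], with no density or
   closedness requirement.  The values of [op_fun] outside [dom] are junk and
   are never used. *)
Record operator := Operator {
  dom : set H;
  op_fun :> H -> H;
  dom0 : dom 0;
  dom_linear : forall (a : scalars R k) (x y : H),
    dom x -> dom y -> dom (a *: x + y);
  op_linear : forall (a : scalars R k) (x y : H),
    dom x -> dom y -> op_fun (a *: x + y) = a *: op_fun x + op_fun y }.

Definition extends (S T : operator) : Prop :=
  dom T `<=` dom S /\ forall f, dom T f -> S f = T f.

(* Positivity is stated with the order of the scalar field: over the complex
   numbers, [0 <= z] means that z is a nonnegative real number. *)
Definition positive_op (T : operator) : Prop :=
  forall f, dom T f -> 0 <= '[T f, f].

Definition positive_symmetric (T : operator) : Prop :=
  (forall f g, dom T f -> dom T g -> '[T f, g] = '[f, T g]) /\ positive_op T.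

(* S is densely defined and its graph is the graph of its adjoint. *)
Definition self_adjoint (S : operator) : Prop :=
  dense (dom S) /\
  forall g z : H, (forall f, dom S f -> '[S f, g] = '[f, z]) <->
                  (dom S g /\ S g = z).

Definition positive_self_adjoint (S : operator) : Prop :=
  self_adjoint S /\ positive_op S.

Definition bounded_op (S : operator) : Prop :=
  exists M : R, forall f, dom S f -> hnorm (S f) <= M * hnorm f.

(* Meaningful for bounded operators only: the real supremum of an unbounded
   set is 0 by convention. *)
Definition op_norm (S : operator) : R :=
  sup [set hnorm (S f) | f in [set f | dom S f /\ hnorm f <= 1]].

Definition bounded_positive_operator (S : operator) : Prop :=
  [/\ dom S = setT, bounded_op S & positive_self_adjoint S].

(* B is the everywhere defined inverse of I + S. *)
Definition is_resolvent (S : operator) (B : H -> H) : Prop :=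
  (forall x, dom S (B x) /\ B x + S (B x) = x) /\
  (forall f, dom S f -> B (f + S f) = f).

(* (I + S2)^-1 <= (I + S1)^-1 as quadratic forms.  The inverses exist as soon
   as S1 and S2 are positive self-adjoint. *)
Definition form_le (S1 S2 : operator) : Prop :=
  exists B1 B2 : H -> H,
    [/\ is_resolvent S1 B1, is_resolvent S2 B2 &
        forall x, '[B2 x, x] <= '[B1 x, x]].

Definition is_krein_von_neumann (T TN : operator) : Prop :=
  [/\ positive_self_adjoint TN, extends TN T &
      forall S, positive_self_adjoint S -> extends S T -> form_le TN S].

Definition D_star (T : operator) : set H :=
  [set g | (ereal_sup
    [set ((re_scalar `|'[T h, g]| ^+ 2)%R)%:E |
       h in [set h | dom T h /\ ('[T h, h] <= 1)%R]] < +oo)%E].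

End Operators.

Arguments operator {R k} H.

(* Main.v *)
Require Import Defs.
From mathcomp Require Import all_boot all_order all_algebra sesquilinear.
From mathcomp Require Import complex ring lra.
From mathcomp Require Import all_classical all_reals all_analysis.

Import Order.TTheory GRing.Theory Num.Theory.
Import numFieldNormedType.Exports.
Local Open Scope classical_set_scope.
Local Open Scope ring_scope.

Set Implicit Arguments.
Unset Strict Implicit.

(* Work with the real inner product [Re (x, y)].  For [g : H], let [u n] be a
   minimizing sequence of [(T h, h) - 2 Re (T h, g)] over the domain of [T]: in
   the completion of the range of [T] for the inner product [(T f, h)], the
   vectors [T (u n)] converge to the adjoint of [J] applied to [g], hence under
   (iii) they also converge in [H], to [J J* g =: N g].  This [N] is positive,
   extends [T], satisfies [|N g|^2 <= gamma (N g, g)], and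
   [0 <= (S (v - u n), v - u n)] yields [(N v, v) <= (S v, v)] for every
   positive self-adjoint extension [S], an inequality of forms that passes to
   the resolvents with the opposite sign.
   The equivalence of (ii) and (iii) is the uniform boundedness principle. *)

(** * Real and complex scalars handled uniformly *)

Section Scalars.
Context {R : realType} {k : scalar_kind}.
Implicit Types (z w : scalars R k) (a b : R).

Definition embed : R -> scalars R k :=
  match k with
  | RealScalars => fun a => a
  | ComplexScalars => fun a => Complex a 0
  end.

Lemma reD z w : re_scalar (z + w) = re_scalar z + re_scalar w.
Proof. by case: k z w => //= -[? ?] [? ?]. Qed.

Lemma reN z : re_scalar (- z) = - re_scalar z.
Proof. by case: k z => //= -[? ?]. Qed.

Lemma re_conj z : re_scalar (conj_scalar z) = re_scalar z.
Proof. by case: k z => //= -[? ?]. Qed.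

Lemma conjK z : conj_scalar (conj_scalar z) = z.
Proof. by case: k z => //= z; rewrite conjcK. Qed.

Lemma re_mul_embed a z : re_scalar (embed a * z) = a * re_scalar z.
Proof. by rewrite /embed; case: k z => //= -[? ?] /=; rewrite mul0r subr0. Qed.

Lemma conj_embed a : conj_scalar (embed a) = embed a.
Proof. by rewrite /embed; case: k => //=; rewrite oppr0. Qed.

Lemma re_embed a : re_scalar (embed a) = a.
Proof. by rewrite /embed; case: k. Qed.

Lemma ler_embed a b : (embed a <= embed b) = (a <= b).
Proof. by rewrite /embed; case: k => //; rewrite lecR. Qed.

Lemma ltr_embed a b : (embed a < embed b) = (a < b).
Proof. by rewrite /embed; case: k => //; rewrite ltcR. Qed.

Lemma embed0 : embed 0 = 0. Proof. by rewrite /embed; case: k. Qed.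

Lemma embed1 : embed 1 = 1. Proof. by rewrite /embed; case: k. Qed.

Lemma embedN a : embed (- a) = - embed a.
Proof.
by rewrite /embed; case: k => //; rewrite -[RHS]/(Complex (- a) (- 0)) oppr0.
Qed.

Lemma embedM a b : embed (a * b) = embed a * embed b.
Proof.
rewrite /embed; case: k => //.
rewrite -[RHS]/(Complex (a * b - 0 * 0) (a * 0 + 0 * b)).
by rewrite !(mulr0, mul0r) subr0 addr0.
Qed.

Lemma ge0_embed z : 0 <= z -> z = embed (re_scalar z).
Proof.
rewrite /embed; case: k z => //= z z0.
by rewrite [RHS](RRe_real (ger0_real z0)).
Qed.

Lemma re_ge0 z : 0 <= z -> 0 <= re_scalar z.
Proof. by move=> z0; rewrite -ler_embed -ge0_embed // embed0. Qed.

Lemma conj_fixed_ge0 z : conj_scalar z = z -> 0 <= re_scalar z -> 0 <= z.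
Proof.
case: k z => //= -[a b] [] bE a0.
have -> : b = 0 by lra.
by rewrite (ler0c a).
Qed.

Lemma re_norm_ge0 z : 0 <= re_scalar `|z|.
Proof. exact/re_ge0/normr_ge0. Qed.

Lemma re_mul_conj z : re_scalar (z * conj_scalar z) = re_scalar `|z| ^+ 2.
Proof.
case: k z => [z|[a b]] /=; first by rewrite real_normK ?num_real.
by rewrite sqr_sqrtr ?addr_ge0 ?sqr_ge0 //; ring.
Qed.

Lemma mul_conj_embed z : z * conj_scalar z = embed (re_scalar `|z| ^+ 2).
Proof.
rewrite -re_mul_conj; apply: ge0_embed.
by case: k z => [z|z] /=; [rewrite -expr2 sqr_ge0|exact: mulcJ_ge0].
Qed.

Lemma normr_re z : `|re_scalar z| <= re_scalar `|z|.
Proof.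
case: k z => [z|[a b]] //=.
by rewrite -sqrtr_sqr ler_wsqrtr // lerDl sqr_ge0.
Qed.

Lemma re_mul_eq0 z : (forall w, re_scalar (w * z) = 0) -> z = 0.
Proof.
move=> /(_ (conj_scalar z)); rewrite mulrC re_mul_conj => /eqP.
rewrite sqrf_eq0 => /eqP n0; apply/normr0_eq0.
by rewrite (ge0_embed (normr_ge0 z)) n0 embed0.
Qed.

End Scalars.

(** * The real inner product and Cauchy-Schwarz inequalities *)

Definition rinner (R : realType) (k : scalar_kind) (H : hilbert_space R k)
  (x y : H) : R := re_scalar (inner H x y).

Local Notation "<[ x , y ]>" := (rinner x y).

Section RealInner.
Context {R : realType} {k : scalar_kind} {H : hilbert_space R k}.
Implicit Types (x y z : H) (c : scalars R k) (a b : R).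

Lemma innerC x y : inner H x y = conj_scalar (inner H y x).
Proof. by rewrite hermitian_subproof expr0 mul1r. Qed.

Lemma innerDl x y z : inner H (x + y) z = inner H x z + inner H y z.
Proof.
(* The structure provides compatibility with subtraction; additivity comes from [x + y = x - (- y)],
   [- y = 0 - y] and [0 = y - y]. *)
have /(_ x (- y)) := @zmod_morphisml_subproof _ _ _ _ _ _ (inner H) z.
have /(_ 0 y) := @zmod_morphisml_subproof _ _ _ _ _ _ (inner H) z.
have /(_ y y) := @zmod_morphisml_subproof _ _ _ _ _ _ (inner H) z.
rewrite !subrr sub0r opprK => -> ->.
by rewrite sub0r opprK.
Qed.

Lemma innerZl c x z : inner H (c *: x) z = c * inner H x z.
Proof. exact: (@linearl_subproof _ _ _ _ _ _ (inner H) z). Qed.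

Lemma innerZr c x z : inner H x (c *: z) = conj_scalar c * inner H x z.
Proof. exact: (@linearr_subproof _ _ _ _ _ _ (inner H) x). Qed.

Lemma rinnerC x y : <[x, y]> = <[y, x]>.
Proof. by rewrite /rinner innerC re_conj. Qed.

Lemma rinnerDl x y z : <[x + y, z]> = <[x, z]> + <[y, z]>.
Proof. by rewrite /rinner innerDl reD. Qed.

Lemma rinnerDr x y z : <[x, y + z]> = <[x, y]> + <[x, z]>.
Proof. by rewrite rinnerC rinnerDl ![<[_, x]>]rinnerC. Qed.

Lemma rinnerZl a x y : <[embed a *: x, y]> = a * <[x, y]>.
Proof. by rewrite /rinner innerZl re_mul_embed. Qed.

Lemma rinnerZr a x y : <[x, embed a *: y]> = a * <[x, y]>.
Proof. by rewrite rinnerC rinnerZl rinnerC. Qed.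

Lemma rinner_conj c x y : <[c *: x, y]> = <[x, conj_scalar c *: y]>.
Proof. by rewrite /rinner innerZl innerZr conjK. Qed.

Lemma rinnerNl x y : <[- x, y]> = - <[x, y]>.
Proof. by rewrite -scaleN1r -(embed1 (R := R)) -embedN rinnerZl mulN1r. Qed.

Lemma rinnerNr x y : <[x, - y]> = - <[x, y]>.
Proof. by rewrite rinnerC rinnerNl rinnerC. Qed.

Lemma rinnerBl x y z : <[x - y, z]> = <[x, z]> - <[y, z]>.
Proof. by rewrite rinnerDl rinnerNl. Qed.

Lemma rinnerBr x y z : <[x, y - z]> = <[x, y]> - <[x, z]>.
Proof. by rewrite rinnerDr rinnerNr. Qed.

Lemma hnorm_ge0 x : 0 <= hnorm x.
Proof. exact/re_ge0/normr_ge0. Qed.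

Lemma norm_embed x : `|x| = embed (hnorm x).
Proof. exact/ge0_embed/normr_ge0. Qed.

Lemma hnormZ c x : hnorm (c *: x) = re_scalar `|c| * hnorm x.
Proof.
rewrite /hnorm normrZ [`|c|]ge0_embed ?normr_ge0 //.
by rewrite re_mul_embed re_embed.
Qed.

Lemma hnormZ_embed a x : 0 <= a -> hnorm (embed a *: x) = a * hnorm x.
Proof.
move=> a0; rewrite hnormZ ger0_norm ?re_embed //.
by rewrite -[X in X <= _](embed0 (R := R)) ler_embed.
Qed.

Lemma hnorm0 : hnorm (0 : H) = 0.
Proof. by rewrite /hnorm normr0 -(embed0 (R := R)) re_embed. Qed.

Lemma hnorm_distC x y : hnorm (x - y) = hnorm (y - x).
Proof. by rewrite /hnorm distrC. Qed.

Lemma ler_hnormD x y : hnorm (x + y) <= hnorm x + hnorm y.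
Proof.
rewrite -(ler_embed (k := k)) -norm_embed (le_trans (ler_normD x y)) //.
by rewrite !norm_embed [leLHS]ge0_embed ?reD ?re_embed // -!norm_embed addr_ge0.
Qed.

Lemma rinner_hnorm x : <[x, x]> = hnorm x ^+ 2.
Proof. by rewrite /rinner inner_norm norm_embed !expr2 -embedM re_embed. Qed.

Lemma rinner_ge0 x : 0 <= <[x, x]>.
Proof. by rewrite rinner_hnorm sqr_ge0. Qed.

Lemma rinner_eq0 x : <[x, x]> = 0 -> x = 0.
Proof.
move=> /eqP; rewrite rinner_hnorm sqrf_eq0 => /eqP x0.
by apply/normr0_eq0; rewrite norm_embed x0 embed0.
Qed.

(* Replacing [x] by scalar multiples recovers the scalar inner product. *)
Lemma rinner_inner x y x' y' :
  (forall c, <[c *: x, y]> = <[c *: x', y']>) -> inner H x y = inner H x' y'.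
Proof.
move=> e; apply/subr0_eq/re_mul_eq0 => c.
by rewrite mulrBr reD reN -!innerZl [X in X - _]e subrr.
Qed.

(** Cauchy-Schwarz for a semidefinite form, in polynomial shape. The form may degenerate, so [c = 0]
    is allowed. *)
Lemma discriminant_le a b (c : R) : 0 <= c ->
  (forall t, 0 <= a - 2 * t * b + t ^+ 2 * c) -> b ^+ 2 <= a * c.
Proof.
move=> cge0 pos; have [c0|c0] := eqVneq c 0.
  rewrite c0 mulr0; have [->|b0] := eqVneq b 0; first by rewrite expr0n.
  (* For [c = 0] the polynomial is affine in [t]; when [b] is nonzero, this [t] gives it the value
     [-1]. *)
  have := pos ((a + 1) / (2 * b)); rewrite c0 mulr0 addr0.
  have -> : a - 2 * ((a + 1) / (2 * b)) * b = - 1 by field.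
  by lra.
have cgt0 : 0 < c by rewrite lt_neqAle eq_sym c0.
have := pos (b / c).
have -> : a - 2 * (b / c) * b + (b / c) ^+ 2 * c = a - b ^+ 2 / c by field.
by rewrite subr_ge0 ler_pdivrMr.
Qed.

Lemma CauchySchwarz x y : `|<[x, y]>| <= hnorm x * hnorm y.
Proof.
rewrite -ler_sqr ?nnegrE ?mulr_ge0 ?hnorm_ge0 // real_normK ?num_real //.
rewrite exprMn -!rinner_hnorm; apply: discriminant_le => [|t].
  exact: rinner_ge0.
have := rinner_ge0 (x - embed t *: y).
rewrite rinnerBl !rinnerBr !rinnerZl !rinnerZr (rinnerC y x).
by congr (_ <= _); ring.
Qed.

(** The phase is absorbed by the second vector: the real inequality is applied to [x] and
    [inner H x y *: y], then one factor [|inner H x y|] cancels. *)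
Lemma CauchySchwarz_scalar x y :
  re_scalar `|inner H x y| <= hnorm x * hnorm y.
Proof.
have [n0|n0] := eqVneq (re_scalar `|inner H x y|) 0.
  by rewrite n0 mulr_ge0 ?hnorm_ge0.
have ngt0 : 0 < re_scalar `|inner H x y|.
  by rewrite lt_neqAle eq_sym n0 re_norm_ge0.
rewrite -(ler_pM2l ngt0) -expr2 -re_mul_conj mulrC -innerZr mulrCA -hnormZ.
exact: le_trans (ler_norm _) (CauchySchwarz _ _).
Qed.

End RealInner.

(** * Norm convergence and uniform boundedness *)

Section Convergence.
Context {R : realType} {k : scalar_kind} {H : hilbert_space R k}.
Implicit Types (u v : nat -> H) (x y l : H) (e : nat -> R).

Definition hcvg u l := (fun n => hnorm (u n - l)) @ \oo --> (0 : R).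

Lemma hilbert_complete u e : e @ \oo --> (0 : R) ->
  (forall n m, (n <= m)%N -> hnorm (u m - u n) <= e n) -> exists l, hcvg u l.
Proof.
move=> e0 ue; have /cauchy_cvgP ul : cauchy (u @ \oo).
  apply/cauchy_exP => eps eps0; have epsE := ge0_embed (ltW eps0).
  have re0 : 0 < re_scalar eps by rewrite -(ltr_embed (k := k)) -epsE embed0.
  have /cvgrPdist_lt/(_ _ re0) [N _ eN] := e0.
  exists (u N); exists N => // n Nn /=.
  rewrite -ball_normE /ball_ /= norm_embed epsE ltr_embed hnorm_distC.
  apply: (le_lt_trans (ue _ _ Nn)); have := eN N (leqnn N).
  by rewrite sub0r normrN; exact/le_lt_trans/ler_norm.
exists (lim (u @ \oo)); apply/cvgrPdist_lt => eps eps0.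
have eps0' : 0 < embed eps :> scalars R k.
  by rewrite -(embed0 (R := R)) ltr_embed.
have /cvgrPdist_lt/(_ _ eps0') := ul; apply: filterS => n.
rewrite norm_embed ltr_embed hnorm_distC sub0r normrN ger0_norm //.
exact: hnorm_ge0.
Qed.

Lemma hcvg_cst x : hcvg (fun=> x) x.
Proof. by rewrite /hcvg subrr hnorm0; exact: cvg_cst. Qed.

Lemma hcvgP u l e : e @ \oo --> (0 : R) ->
  (forall n, hnorm (u n - l) <= e n) -> hcvg u l.
Proof.
move=> e0 ue; apply: squeeze_cvgr e0; last exact: cvg_cst.
by apply: nearW => n; rewrite hnorm_ge0 ue.
Qed.

Lemma hcvgD u v l (m : H) :
  hcvg u l -> hcvg v m -> hcvg (fun n => u n + v n) (l + m).
Proof.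
move=> ul vm.
apply: (@hcvgP _ _ (fun n => hnorm (u n - l) + hnorm (v n - m))) => [|n].
  by rewrite -[0]addr0; exact: cvgD ul vm.
by rewrite opprD addrACA; exact: ler_hnormD.
Qed.

Lemma hcvgZ c u l : hcvg u l -> hcvg (fun n => c *: u n) (c *: l).
Proof.
move=> ul; apply: (@hcvgP _ _ (fun n => re_scalar `|c| * hnorm (u n - l))).
  by rewrite -[0](mulr0 (re_scalar `|c|)); exact: cvgM (cvg_cst _) ul.
by move=> n; rewrite -scalerBr hnormZ.
Qed.

Lemma cvg_dist_le e e' (a : R) : e' @ \oo --> (0 : R) ->
  (forall n, `|e n - a| <= e' n) -> e @ \oo --> a.
Proof.
move=> e0 fe; apply/subr_cvg0/norm_cvg0P.
apply: squeeze_cvgr e0; last exact: cvg_cst.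
by apply: nearW => n; rewrite normr_ge0 fe.
Qed.

Lemma cvg_sqr_le e e' : e' @ \oo --> (0 : R) ->
  (forall n, e n ^+ 2 <= e' n) -> e @ \oo --> (0 : R).
Proof.
move=> e0 fe; apply/cvgr0Pnorm_lt => eps eps0.
have eps2 : 0 < eps ^+ 2 by rewrite exprn_gt0.
have /cvgr0Pnorm_lt/(_ _ eps2) := e0; apply: filterS => n en.
rewrite -ltr_sqr ?nnegrE ?normr_ge0 ?(ltW eps0) // real_normK ?num_real //.
exact: le_lt_trans (fe n) (le_lt_trans (ler_norm _) en).
Qed.

Lemma cvg_rinner u v l (m : H) : hcvg u l -> hcvg v m ->
  (fun n => <[u n, v n]>) @ \oo --> <[l, m]>.
Proof.
move=> ul vm.
apply: (@cvg_dist_le _ (fun n => hnorm (u n - l) * hnorm (v n - m) +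
  (hnorm (u n - l) * hnorm m + hnorm l * hnorm (v n - m)))) => [|n].
  have -> : 0 = 0 * 0 + (0 * hnorm m + hnorm l * 0) :> R.
    by rewrite !mul0r mulr0 !addr0.
  apply: cvgD; first exact: cvgM.
  by apply: cvgD; [exact: cvgM ul (cvg_cst _)|exact: cvgM (cvg_cst _) vm].
have -> : <[u n, v n]> - <[l, m]> =
    <[u n - l, v n - m]> + (<[u n - l, m]> + <[l, v n - m]>).
  by rewrite !(rinnerBl, rinnerBr); ring.
apply: (le_trans (ler_normD _ _)); apply: lerD; first exact: CauchySchwarz.
by apply: (le_trans (ler_normD _ _)); apply: lerD; exact: CauchySchwarz.
Qed.

(* A gliding hump: a step of length [4^-n] along [y n] is made exactly when the
   current point does not yet pair with [y n] to at least [4^-n |y n| / 2]; the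
   later steps add up to at most [4^-n / 3]. *)
Lemma uniform_boundedness (F : set H) :
  (forall x, exists M : R, forall y, F y -> `|<[x, y]>| <= M) ->
  exists M : R, forall y, F y -> hnorm y <= M.
Proof.
move=> ptb; apply: contrapT => unb.
have /choice[y yP] (n : nat) : exists y, F y /\ n%:R * 4 ^+ n < hnorm y.
  apply: contrapT => no; apply: unb; exists (n%:R * 4 ^+ n) => y Fy.
  by rewrite leNgt; apply/negP => lt; apply: no; exists y.
pose s n : R := 4^-1 ^+ n.
have s_gt0 n : 0 < s n by rewrite /s exprn_gt0 // invr_gt0.
pose step n x := if s n / 2 * hnorm (y n) <= `|<[x, y n]>| then x
  else x + embed (s n / hnorm (y n)) *: y n.
pose fix x n := if n is p.+1 then step p (x p) else 0 : H.
have xS n : x n.+1 = step n (x n) by [].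
have ygt0 n : 0 < hnorm (y n).
  by apply: le_lt_trans (yP n).2; rewrite mulr_ge0 // exprn_ge0.
have step_dist n : hnorm (x n.+1 - x n) <= s n.
  rewrite xS /step; case: ifP => _; first by rewrite subrr hnorm0 ltW.
  rewrite addrAC subrr add0r hnormZ_embed; last by apply: divr_ge0; exact: ltW.
  by rewrite divfK // gt_eqF.
have step_big n : s n / 2 * hnorm (y n) <= `|<[x n.+1, y n]>|.
  rewrite xS /step; case: ifPn => //; rewrite -ltNge => small.
  rewrite rinnerDl rinnerZl rinner_hnorm.
  have -> : s n / hnorm (y n) * hnorm (y n) ^+ 2 = s n * hnorm (y n).
    by rewrite expr2 mulrA divfK // gt_eqF.
  have := lerB_normD (s n * hnorm (y n)) (<[x n, y n]>).
  rewrite [X in _ <= `|X|]addrC [`|s n * _|]ger0_norm.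
    by apply: le_trans; lra.
  by apply: mulr_ge0; exact: ltW.
have tail n p : hnorm (x (n + p)%N - x n) <= 4 / 3 * s n.
  (* The sharper telescoping bound is what makes the induction on [p] close. *)
  have : hnorm (x (n + p)%N - x n) <= 4 / 3 * (s n - s (n + p)%N).
    elim: p => [|p IH]; first by rewrite addn0 !subrr hnorm0 mulr0.
    rewrite addnS.
    have -> : x (n + p).+1 - x n =
        (x (n + p).+1 - x (n + p)%N) + (x (n + p)%N - x n).
      by rewrite addrA subrK.
    apply: (le_trans (ler_hnormD _ _)).
    have := step_dist (n + p)%N.
    have -> : s (n + p).+1 = 4^-1 * s (n + p)%N by rewrite /s exprS.
    by lra.
  by have := s_gt0 (n + p)%N; lra.
have s0 : (fun n => 4 / 3 * s n) @ \oo --> (0 : R).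
  rewrite -[0](mulr0 (4 / 3)); apply: cvgM; first exact: cvg_cst.
  by apply: cvg_expr; rewrite ger0_norm ?invr_ge0 // invf_lt1 // ltr1n.
have [n m nm|z xz] := hilbert_complete s0 (u := x).
  by rewrite -(subnKC nm).
have z_near n : hnorm (x n - z) <= 4 / 3 * s n.
  have d0 : (fun p => 4 / 3 * s n + hnorm (x p - z)) @ \oo --> 4 / 3 * s n.
    by rewrite -[X in _ --> X]addr0; apply: cvgD xz; exact: cvg_cst.
  apply: (ler_cvg_to (cvg_cst (hnorm (x n - z))) d0).
  exists n => // p /= /subnKC <-.
  rewrite -[x n - z](subrKA (x (n + (p - n))%N)).
  by rewrite (le_trans (ler_hnormD _ _)) // lerD2r hnorm_distC.
have [M zM] := ptb z.
(* Replacing [x n.+1] by [z] costs at most [4/3 * 1/4 = 1/3] of [s n |y n|], so [z] pairs with [y n]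
   to at least [(1/2 - 1/3) s n |y n| > n / 6]; hence the factor 6. *)
have [n Mn] : exists n : nat, 6 * M < n%:R.
  by exists (Num.truncn (6 * M)).+1; rewrite truncnS_gt.
have := zM _ (yP n).1; have := step_big n.
have -> : <[x n.+1, y n]> = <[z, y n]> + <[x n.+1 - z, y n]>.
  by rewrite -rinnerDl addrC subrK.
move=> big zyn.
have := le_trans big (ler_normD _ _).
have := CauchySchwarz (x n.+1 - z) (y n).
have : hnorm (x n.+1 - z) * hnorm (y n) <= 4 / 3 * s n.+1 * hnorm (y n).
  by rewrite ler_wpM2r ?z_near // ltW.
have -> : s n.+1 = 4^-1 * s n by rewrite /s exprS.
have : n%:R < s n * hnorm (y n).
  rewrite /s exprVn mulrC ltr_pdivlMr ?exprn_gt0 //; exact: (yP n).2.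
by lra.
Qed.

End Convergence.

(** * Arithmetic of operators and near minimizers of a positive form *)

Section OperatorTheory.
Context {R : realType} {k : scalar_kind} {H : hilbert_space R k}.
Implicit Types (T S A : operator H) (x y z f g h : H) (c : scalars R k)
  (a b : R) (u v : nat -> H).

Lemma domD T x y : dom T x -> dom T y -> dom T (x + y).
Proof. by move=> Tx Ty; rewrite -[x]scale1r; exact: dom_linear. Qed.

Lemma domZ T c x : dom T x -> dom T (c *: x).
Proof.
by move=> Tx; rewrite -[_ *: _]addr0; apply: dom_linear => //; exact: dom0.
Qed.

Lemma domB T x y : dom T x -> dom T y -> dom T (x - y).
Proof. by move=> Tx Ty; rewrite -scaleN1r; apply: domD => //; exact: domZ. Qed.

Lemma opD T x y : dom T x -> dom T y -> T (x + y) = T x + T y.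
Proof.
by move=> Tx Ty; rewrite -[x in LHS]scale1r op_linear // scale1r.
Qed.

Lemma op0 T : T 0 = 0.
Proof.
have := opD (dom0 T) (dom0 T); rewrite addr0 => /eqP.
by rewrite -subr_eq0 opprD addNKr oppr_eq0 => /eqP.
Qed.

Lemma opZ T c x : dom T x -> T (c *: x) = c *: T x.
Proof.
by move=> Tx; rewrite -[_ *: x]addr0 op_linear ?op0 ?addr0 //; exact: dom0.
Qed.

Lemma opB T x y : dom T x -> dom T y -> T (x - y) = T x - T y.
Proof.
move=> Tx Ty; rewrite -[- y]scaleN1r -[- T y]scaleN1r opD ?opZ //.
exact: domZ.
Qed.

Lemma rinner_symmetric T f g : positive_symmetric T -> dom T f -> dom T g ->
  <[T f, g]> = <[f, T g]>.
Proof. by move=> [sym _] Tf Tg; rewrite /rinner sym. Qed.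

Lemma rinner_positive T f : positive_symmetric T -> dom T f -> 0 <= <[T f, f]>.
Proof. by move=> [_ pos] Tf; exact/re_ge0/pos. Qed.

(* The witness is a near minimizer of [<[A h, h]> - 2 phi h]. *)
Lemma near_representer A (phi : H -> R) C (e : R) : positive_symmetric A ->
    (forall a x y, dom A x -> dom A y ->
       phi (embed a *: x + y) = a * phi x + phi y) ->
    0 <= C -> (forall h, dom A h -> phi h ^+ 2 <= C * <[A h, h]>) -> 0 < e ->
  exists h, dom A h /\
    forall x, dom A x -> (<[A x, h]> - phi x) ^+ 2 <= e * <[A x, x]>.
Proof.
move=> psA phi_lin C0 phiC e0; pose q h := <[A h, h]> - 2 * phi h.
have q_ge h : dom A h -> - C <= q h.
  move=> Ah; rewrite leNgt; apply/negP; rewrite /q => lt.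
  (* From [s - 2 p < - C] follows [2 p > s + C >= 0], so [4 p^2 > (s + C)^2 >= 4 C s], against
     [p^2 <= C s]. *)
  have := phiC _ Ah; have s0 := rinner_positive psA Ah.
  set s := <[A h, h]> in lt s0 *; set p := phi h in lt *; move=> ps.
  have : (s + C) ^+ 2 < (2 * p) ^+ 2.
    by rewrite ltr_sqr ?nnegrE; lra.
  by have := sqr_ge0 (s - C); lra.
pose Q := [set q h | h in dom A].
have Qlb : has_lbound Q by exists (- C) => _ [h Ah <-]; exact: q_ge.
have Qinf : has_inf Q by split=> //; exists (q 0), 0 => //; exact: dom0.
have [_ [h Ah <-] qh] := inf_adherent e0 Qinf.
exists h; split=> // x Ax.
apply: discriminant_le => [|t]; first exact: rinner_positive.
(* Comparing [h] with [h - t x] yields [0 <= e - 2 t b + t^2 <[A x, x]>] for [b = <[A x, h]> - phi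
   x]. *)
have Atx : dom A (embed (- t) *: x) by exact: domZ.
have : inf Q <= q (embed (- t) *: x + h).
  by apply: ge_inf => //; exists (embed (- t) *: x + h) => //; exact: domD.
rewrite /q phi_lin // opD // opZ //.
rewrite !(rinnerDl, rinnerDr, rinnerZl, rinnerZr).
rewrite (rinner_symmetric psA Ah Ax) (rinnerC h).
by move: qh; rewrite /q; lra.
Qed.

(** Near minimizers are Cauchy for the form: its value [s] at [h - h'] is the difference of the two
    residuals there, so [s^2 <= 2 (e + e') s]. *)
Lemma representer_dist A (phi : H -> R) e e' h h' : positive_symmetric A ->
    dom A h -> dom A h' ->
    (forall x, dom A x -> (<[A x, h]> - phi x) ^+ 2 <= e * <[A x, x]>) ->
    (forall x, dom A x -> (<[A x, h']> - phi x) ^+ 2 <= e' * <[A x, x]>) ->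
    0 <= e -> 0 <= e' ->
  <[A (h - h'), h - h']> <= 2 * (e + e').
Proof.
move=> psA Ah Ah' eh eh' e0 e'0; have Ahh := domB Ah Ah'.
have := eh _ Ahh; have := eh' _ Ahh; have := rinner_positive psA Ahh.
have -> : <[A (h - h'), h - h']> =
    (<[A (h - h'), h]> - phi (h - h')) - (<[A (h - h'), h']> - phi (h - h')).
  by rewrite rinnerBr; ring.
set p := _ - phi _; set p' := _ - phi _ => s0 p'e pe.
have [->|sn0] := eqVneq (p - p') 0; first by rewrite mulr_ge0 // addr_ge0.
have sgt0 : 0 < p - p' by rewrite lt_neqAle eq_sym sn0.
rewrite -(ler_pM2r sgt0); have := sqr_ge0 (p + p').
by lra.
Qed.

End OperatorTheory.

(** * Approximating sequences and the graph of the extension *)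

Section Krein.
Context {R : realType} {k : scalar_kind} {H : hilbert_space R k}.
Implicit Types (T S A : operator H) (x y z f g h : H) (c : scalars R k)
  (a b : R) (u v : nat -> H) (e : nat -> R).

(** As [harmonic] decreases, the sum is at most [2 * harmonic n] for [n <= m], which gives a rate in
    the smaller index alone. *)
Lemma hilbert_complete_harmonic u C : 0 <= C ->
  (forall n m, hnorm (u m - u n) ^+ 2 <= C * (harmonic m + harmonic n)) ->
  exists l, hcvg u l.
Proof.
move=> C0 uC; pose e n : R := Num.sqrt (C * (2 * harmonic n)).
have b_ge0 n : 0 <= C * (2 * harmonic n) :> R.
  by rewrite !mulr_ge0 ?harmonic_ge0.
apply: (@hilbert_complete _ _ _ u e) => [|n m nm].
  apply: (@cvg_sqr_le _ _ (fun n => C * (2 * harmonic n))) => [|n].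
    have -> : 0 = C * (2 * 0) :> R by rewrite !mulr0.
    apply: cvgM; first exact: cvg_cst.
    by apply: cvgM cvg_harmonic; exact: cvg_cst.
  by rewrite sqr_sqrtr.
rewrite -ler_sqr ?nnegrE ?hnorm_ge0 ?sqrtr_ge0 // sqr_sqrtr //.
apply: le_trans (uC n m) _; apply: ler_wpM2l => //.
have : harmonic m <= harmonic n :> R.
  by rewrite /harmonic lef_pV2 ?posrE ?ltr0n // ler_nat ltnS.
by lra.
Qed.

(** Riesz representation of [phi] in the completion for the form of [A], the representing vector
    being replaced by a sequence in the domain. It serves for [T] and for [I + S]. *)
Lemma representing_sequence A (phi : H -> R) C : positive_symmetric A ->
    (forall a x y, dom A x -> dom A y ->
       phi (embed a *: x + y) = a * phi x + phi y) ->
    0 <= C -> (forall h, dom A h -> phi h ^+ 2 <= C * <[A h, h]>) ->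
  exists u, (forall n, dom A (u n)) /\
    forall n x, dom A x ->
      (<[A x, u n]> - phi x) ^+ 2 <= harmonic n * <[A x, x]>.
Proof.
move=> psA phi_lin C0 phiC.
have /choice[u uP] n := near_representer psA phi_lin C0 phiC (harmonic_gt0 n).
by exists u; split=> [n|n x Ax]; have [uA /(_ _) ux] := uP n; auto.
Qed.

(** Symmetry lifts from real parts by inserting a scalar in the first argument. Then
    [inner H (T f) f] is fixed by conjugation, so its nonnegativity is read off its real part. *)
Lemma positive_symmetricP T :
  (forall f g, dom T f -> dom T g -> <[T f, g]> = <[f, T g]>) ->
  (forall f, dom T f -> 0 <= <[T f, f]>) -> positive_symmetric T.
Proof.
move=> sym pos.
have symT f g : dom T f -> dom T g -> inner H (T f) g = inner H f (T g).
  move=> Tf Tg; apply: rinner_inner => c; rewrite -opZ //.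
  by apply: sym => //; exact: domZ.
split=> // f Tf; apply: conj_fixed_ge0; last exact: pos.
by rewrite -innerC symT.
Qed.

(* The vectors [T (u n)] of the completion of the range of [T] converge to the
   adjoint of [J] at [g], at a rate [e]. *)
Definition krein_approx T g z u e :=
  [/\ forall n, dom T (u n), e @ \oo --> (0 : R),
      forall n x, dom T x -> <[T x, u n - g]> ^+ 2 <= e n * <[T x, x]> &
      hcvg (fun n => T (u n)) z].

(** A relation, because existence and uniqueness of [z] are derived later, from (iii). *)
Definition krein_graph T g z := exists u e, krein_approx T g z u e.

(** The limit of [<[T (u n), g]>] is known and the squared residual is at most [e n] times the form,
    so it remains to bound the form along [u]. *)
Lemma krein_approx_form T g z u e : positive_symmetric T ->
  krein_approx T g z u e -> (fun n => <[T (u n), u n]>) @ \oo --> <[z, g]>.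
Proof.
move=> psT [uT e0 ue Tuz].
have pz : (fun n => <[T (u n), g]>) @ \oo --> <[z, g]>.
  by apply: cvg_rinner => //; exact: hcvg_cst.
have d0 : (fun n => <[T (u n), u n - g]>) @ \oo --> (0 : R).
  (* From [(s - p)^2 <= |e| s], dropping [p^2] and dividing by [s] gives [s <= 2 p + |e|]. The
     absolute value is there because no sign of [e n] is assumed. *)
  apply: (@cvg_sqr_le _ _ (fun n => `|e n| * (2 * <[T (u n), g]> + `|e n|))).
    have ne0 : (fun n => `|e n|) @ \oo --> (0 : R) by apply/norm_cvg0P.
    rewrite -[0](mul0r (2 * <[z, g]> + 0)); apply: cvgM => //.
    by apply: cvgD => //; apply: cvgM => //; exact: cvg_cst.
  move=> n; have := ue n _ (uT n); have := rinner_positive psT (uT n).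
  rewrite rinnerBr; set s := <[_, u n]>; set p := <[_, g]> => s0 sp.
  have {}sp : (s - p) ^+ 2 <= `|e n| * s.
    by apply: le_trans sp _; rewrite ler_wpM2r // ler_norm.
  apply: (le_trans sp); apply: ler_wpM2l => //.
  have e_ge0 := normr_ge0 (e n).
  have [s_eq0|sn0] := eqVneq s 0.
    have /eqP : p ^+ 2 = 0 by have := sqr_ge0 p; rewrite s_eq0 in sp; lra.
    by rewrite sqrf_eq0 => /eqP ->; lra.
  have sgt0 : 0 < s by rewrite lt_neqAle eq_sym sn0.
  by rewrite -(ler_pM2r sgt0); have := sqr_ge0 p; lra.
rewrite -[<[z, g]>]add0r.
have -> : (fun n => <[T (u n), u n]>) =
    (fun n => <[T (u n), u n - g]> + <[T (u n), g]>).
  by apply/funext => n; rewrite rinnerBr subrK.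
exact: cvgD.
Qed.

(** The residual of [u'] tested on [u n] has square at most [e' n] times a convergent form, so it
    tends to zero. *)
Lemma krein_approx_pairing T g z u e g' z' u' e' : positive_symmetric T ->
  krein_approx T g z u e -> krein_approx T g' z' u' e' ->
  (fun n => <[T (u n), u' n]>) @ \oo --> <[z, g']>.
Proof.
move=> psT ku [uT' e0' ue' Tuz'].
have [uT e0 ue Tuz] := ku.
rewrite -[<[z, g']>]add0r.
have -> : (fun n => <[T (u n), u' n]>) =
    (fun n => <[T (u n), u' n - g']> + <[T (u n), g']>).
  by apply/funext => n; rewrite rinnerBr subrK.
apply: cvgD; last by apply: cvg_rinner => //; exact: hcvg_cst.
apply: (@cvg_sqr_le _ _ (fun n => e' n * <[T (u n), u n]>)).
  rewrite -[0](mul0r <[z, g]>).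
  by apply: cvgM => //; exact: krein_approx_form ku.
by move=> n; exact: ue'.
Qed.

(** Both sides are limits of [<[T (u n), u' n]>], by symmetry of [T]. *)
Lemma krein_graph_sym T g z g' z' : positive_symmetric T ->
  krein_graph T g z -> krein_graph T g' z' -> <[z, g']> = <[g, z']>.
Proof.
move=> psT [u [e ku]] [u' [e' ku']]; rewrite [RHS]rinnerC.
apply: (cvg_unique _ (krein_approx_pairing psT ku ku')) => //.
have -> : (fun n => <[T (u n), u' n]>) = (fun n => <[T (u' n), u n]>).
  apply/funext => n; rewrite rinnerC (rinner_symmetric psT) //.
    by case: ku'.
  by case: ku.
exact: krein_approx_pairing ku' ku.
Qed.

Lemma krein_graph_ge0 T g z : positive_symmetric T ->
  krein_graph T g z -> 0 <= <[z, g]>.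
Proof.
move=> psT [u [e ku]].
apply: (ler_cvg_to (cvg_cst 0) (krein_approx_form psT ku)).
apply: nearW => n; apply: rinner_positive => //.
by case: ku.
Qed.

Lemma krein_graph_linear T c g z g' z' : positive_symmetric T ->
  krein_graph T g z -> krein_graph T g' z' ->
  krein_graph T (c *: g + g') (c *: z + z').
Proof.
move=> psT [u [e [uT e0 ue Tuz]]] [u' [e' [uT' e0' ue' Tuz']]].
exists (fun n => c *: u n + u' n).
(* The 2 comes from [(p + p')^2 <= 2 p^2 + 2 p'^2]; moving [c] onto [x] as its conjugate multiplies
   the form by [|c|^2]. *)
exists (fun n => 2 * (re_scalar `|c| ^+ 2 * e n + e' n)); split.
- by move=> n; exact: dom_linear.
- rewrite -[0](mulr0 2); apply: cvgM; first exact: cvg_cst.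
  rewrite -[0 in X in _ --> X]addr0; apply: cvgD => //.
  rewrite -[0](mulr0 (re_scalar `|c| ^+ 2)).
  by apply: cvgM => //; exact: cvg_cst.
- move=> n x Tx.
  have -> : c *: u n + u' n - (c *: g + g') = c *: (u n - g) + (u' n - g').
    by rewrite scalerBr opprD addrACA.
  rewrite rinnerDr.
  have := ue' n _ Tx; have := ue n _ (domZ (conj_scalar c) Tx).
  rewrite (opZ _ Tx) !(rinner_conj (conj_scalar c)) conjK scalerA.
  rewrite mul_conj_embed rinnerZr; set p := <[T x, c *: (u n - g)]>.
  set p' := <[T x, u' n - g']>; set s := <[T x, x]> => pe p'e.
  by have := sqr_ge0 (p - p'); lra.
- have -> : (fun n => T (c *: u n + u' n)) = (fun n => c *: T (u n) + T (u' n)).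
    by apply/funext => n; rewrite op_linear.
  by apply: hcvgD => //; exact: hcvgZ.
Qed.

Lemma krein_graph_extends T g : dom T g -> krein_graph T g (T g).
Proof.
move=> Tg; exists (fun=> g), (fun=> 0); split=> //.
- exact: cvg_cst.
- move=> _ x Tx; rewrite subrr.
  by rewrite -(subrr x) rinnerBr subrr expr0n mul0r.
- exact: hcvg_cst.
Qed.

(** Positivity of [S] at [g - u n] reads [2 <[T (u n), g]> - <[T (u n), u n]> <= <[S g, g]>], whose
    left side tends to [2 <[z, g]> - <[z, g]>]. *)
Lemma krein_graph_le_extension T S g z : positive_symmetric T ->
  positive_symmetric S -> extends S T -> krein_graph T g z -> dom S g ->
  <[z, g]> <= <[S g, g]>.
Proof.
move=> psT psS [TS ST] [u [e ku]] Sg; have [uT e0 ue Tuz] := ku.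
have cv : (fun n => 2 * <[T (u n), g]> - <[T (u n), u n]>) @ \oo -->
    2 * <[z, g]> - <[z, g]>.
  apply: cvgB; last exact: krein_approx_form ku.
  apply: cvgM; first exact: cvg_cst.
  by apply: cvg_rinner => //; exact: hcvg_cst.
have -> : <[z, g]> = 2 * <[z, g]> - <[z, g]> by ring.
apply: (ler_cvg_to cv (cvg_cst _)); apply: nearW => n.
have Su := TS _ (uT n).
have := rinner_positive psS (domB Sg Su).
rewrite opB // !(rinnerBl, rinnerBr) (rinner_symmetric psS Sg Su) (ST _ (uT n)).
rewrite (rinnerC g).
by lra.
Qed.

(** * Consequences of (iii) for the graph *)

Section Bounded.
Context {T : operator H} {gamma : R}.
Context (psT : positive_symmetric T) (gamma0 : 0 < gamma).
Context (T_bound : forall f, dom T f -> hnorm (T f) ^+ 2 <= gamma * <[T f, f]>).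

Lemma krein_graph_ex g : exists z, krein_graph T g z.
Proof.
have [|a x y Tx Ty||h Th|u [uT ue]] :=
    @representing_sequence T (fun x => <[T x, g]>) (gamma * hnorm g ^+ 2).
- exact: psT.
- rewrite op_linear // rinnerDl rinnerZl //.
- by rewrite mulr_ge0 ?sqr_ge0 // ltW.
(* Cauchy-Schwarz followed by (iii) produces the constant [gamma |g|^2]. *)
- have := CauchySchwarz (T h) g.
  rewrite -ler_sqr ?nnegrE ?mulr_ge0 ?hnorm_ge0 // real_normK ?num_real //.
  move/le_trans; apply; rewrite exprMn [leRHS]mulrAC.
  by rewrite ler_wpM2r ?sqr_ge0 // T_bound.
(* Here (iii) turns closeness of [u n] and [u m] in the form into closeness of [T (u n)] and
   [T (u m)] in norm. *)
have [|n m|z Tuz] := @hilbert_complete_harmonic (fun n => T (u n)) (gamma * 2).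
- by rewrite mulr_ge0 // ltW.
- rewrite -opB //; apply: le_trans (T_bound (domB _ _)) _ => //.
  rewrite -mulrA ler_wpM2l ?(ltW gamma0) //.
  by apply: (representer_dist psT _ _ (ue m) (ue n)); rewrite ?harmonic_ge0.
exists z, u, harmonic; split=> //; first exact: cvg_harmonic.
by move=> n x Tx; rewrite rinnerBr ue.
Qed.

Lemma krein_graph_bound g z :
  krein_graph T g z -> hnorm z ^+ 2 <= gamma * <[z, g]>.
Proof.
move=> [u [e ku]]; have [uT e0 ue Tuz] := ku.
rewrite -rinner_hnorm.
have cv : (fun n => gamma * <[T (u n), u n]>) @ \oo --> gamma * <[z, g]>.
  by apply: cvgM (krein_approx_form psT ku); exact: cvg_cst.
apply: (ler_cvg_to (cvg_rinner Tuz Tuz) cv); apply: nearW => n.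
by rewrite rinner_hnorm T_bound.
Qed.

(** By linearity [z - z'] lies over [0], where the bound forces it to vanish. *)
Lemma krein_graph_unique g z z' :
  krein_graph T g z -> krein_graph T g z' -> z = z'.
Proof.
move=> kz kz'; have := krein_graph_linear (-1) psT kz' kz.
rewrite !scaleN1r !(addrC (- _)) subrr => /krein_graph_bound.
have -> : <[z - z', 0]> = 0 by rewrite -(subrr z) rinnerBr subrr.
rewrite mulr0 -rinner_hnorm => le0.
by apply/subr0_eq/rinner_eq0/le_anti; rewrite le0 rinner_ge0.
Qed.

Lemma krein_operator : exists N : operator H,
  dom N = setT /\ forall g, krein_graph T g (N g).
Proof.
have /choice[N NP] := krein_graph_ex.
have N_lin c x y : setT x -> setT y -> N (c *: x + y) = c *: N x + N y.
  by move=> _ _; apply: krein_graph_unique (NP _) _; exact: krein_graph_linear.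
by exists (@Operator _ _ _ setT N Logic.I (fun _ _ _ _ _ => Logic.I) N_lin).
Qed.

End Bounded.

End Krein.

(** * Resolvents and the form order *)

Section Resolvent.
Context {R : realType} {k : scalar_kind} {H : hilbert_space R k}.
Implicit Types (T S N : operator H) (x y z f g h : H) (c : scalars R k)
  (a b : R) (u v : nat -> H) (B : H -> H).

Lemma positive_self_adjoint_symmetric S :
  positive_self_adjoint S -> positive_symmetric S.
Proof.
move=> [[_ adj] pos]; split=> // f g Sf Sg.
by have [_ +] := adj g (S g); apply.
Qed.

Lemma total_symmetric_self_adjoint S : dom S = setT ->
  positive_symmetric S -> positive_self_adjoint S.
Proof.
move=> domS [sym pos]; split=> //; split.
  by move=> O [x Ox] _; exists x; rewrite domS; split.
have dS x : dom S x by rewrite domS.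
move=> g z; split=> [adj|[_ <-] f _]; last exact: sym.
split=> //; apply/subr0_eq/rinner_eq0.
have := adj (S g - z) (dS _); rewrite sym // => e.
by rewrite rinnerBr /rinner e subrr.
Qed.

Lemma id_plus_linear S c x y : dom S x -> dom S y ->
  c *: x + y + S (c *: x + y) = c *: (x + S x) + (y + S y).
Proof. by move=> Sx Sy; rewrite op_linear // scalerDr addrACA. Qed.

Definition id_plus S :=
  Operator (dom0 S) (@dom_linear _ _ _ S) (@id_plus_linear S).

Lemma id_plus_symmetric S :
  positive_symmetric S -> positive_symmetric (id_plus S).
Proof.
move=> psS; apply: positive_symmetricP => [f g|f] /= Sf; last first.
  by rewrite rinnerDl addr_ge0 ?rinner_ge0 ?(rinner_positive psS).
by move=> Sg; rewrite rinnerDl rinnerDr (rinner_symmetric psS).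
Qed.

(** The form of [I + S] dominates the squared norm, so a sequence representing [x] converges in [H].
    Its limit [y] solves the adjoint equation, and self-adjointness places it in the domain of
    [S]. *)
Lemma resolvent_ex S : positive_self_adjoint S -> exists B, is_resolvent S B.
Proof.
move=> psaS; have psS := positive_self_adjoint_symmetric psaS.
have psA := id_plus_symmetric psS.
have form_ge f : dom S f -> hnorm f ^+ 2 <= <[id_plus S f, f]>.
  by move=> Sf; rewrite rinnerDl rinner_hnorm lerDl (rinner_positive psS).
have /choice[B BP] x : exists y, dom S y /\ y + S y = x.
  have [| | |u [uS ux]] :=
    @representing_sequence _ _ _ (id_plus S) (fun y => <[y, x]>)
      (hnorm x ^+ 2) psA.
  - by move=> a f g _ _; rewrite rinnerDl rinnerZl.
  - exact: sqr_ge0.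
  - move=> f Sf; have := CauchySchwarz f x.
    rewrite -ler_sqr ?nnegrE ?mulr_ge0 ?hnorm_ge0 // real_normK ?num_real //.
    move/le_trans; apply; rewrite exprMn mulrC.
    by rewrite ler_wpM2l ?sqr_ge0 // form_ge.
  have [|n m|y uy] := @hilbert_complete_harmonic _ _ _ u 2; first by [].
    apply: le_trans (form_ge _ (domB (uS m) (uS n))) _.
    by apply: (representer_dist psA _ _ (ux m) (ux n));
      rewrite ?harmonic_ge0 ?uS.
  exists y; have adj f : dom S f -> <[S f, y]> = <[f, x - y]>.
    move=> Sf; suff yE : <[f + S f, y]> = <[f, x]>.
      by rewrite rinnerBr -yE rinnerDl; ring.
    have cv := cvg_rinner (hcvg_cst (f + S f)) uy.
    apply: (cvg_unique _ cv) => //; apply/subr_cvg0.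
    apply: (@cvg_sqr_le _ _ (fun n => harmonic n * <[f + S f, f]>)) => [|n].
      rewrite -[0](mul0r <[f + S f, f]>).
      by apply: cvgM cvg_harmonic _; exact: cvg_cst.
    exact: (ux n f Sf).
  have [_ /(_ y (x - y)) [+ _]] := psaS.1.
  move=> []; last by move=> Sy ->; rewrite addrC subrK.
  move=> f Sf; apply: rinner_inner => c; rewrite -opZ //.
  by apply: adj; exact: domZ.
exists B; split=> // f Sf.
have [Sw wE] := BP (f + S f).
apply/subr0_eq/rinner_eq0; set w := B _ - f.
have Sw' : dom S w by exact: domB.
have : w + S w = 0 by rewrite /w opB // addrACA wE -opprD subrr.
(* Here [<[S w, w]> = - |w|^2], so positivity forces [w = 0]. *)
move=> w0; have := rinner_positive psS Sw'.
have -> : S w = - w by apply/eqP; rewrite -addr_eq0 addrC w0.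
rewrite rinnerNl oppr_ge0 => le0.
by apply/le_anti; rewrite le0 rinner_ge0.
Qed.

(** Substituting [x = B x + S (B x)] exhibits a nonnegative scalar, so that resolvent forms can be
    compared in [R]. *)
Lemma resolvent_inner S B x : positive_symmetric S -> is_resolvent S B ->
  inner H (B x) x = embed <[B x, x]>.
Proof.
move=> [_ pos] [/(_ x) [SB Bx] _]; apply: ge0_embed.
rewrite -{2}Bx innerC innerDl inner_norm.
have ge0 : 0 <= `|B x| ^+ 2 + inner H (S (B x)) (B x).
  by rewrite addr_ge0 ?exprn_ge0 ?pos.
by rewrite [X in conj_scalar X]ge0_embed // conj_embed -ge0_embed.
Qed.

(* With [x = u + N u = v + S v] and [t] the form of [I + N], the difference of
   the two sides is at least [t (u - v, u - v)]. *)
Lemma resolvent_le N S B1 B2 x : dom N = setT ->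
  positive_symmetric N -> positive_symmetric S ->
  (forall f, dom S f -> <[N f, f]> <= <[S f, f]>) ->
  is_resolvent N B1 -> is_resolvent S B2 ->
  inner H (B2 x) x <= inner H (B1 x) x.
Proof.
move=> domN psN psS leNS res1 res2.
rewrite (resolvent_inner _ psN res1) (resolvent_inner _ psS res2) ler_embed.
have [/(_ x) [_ uE] _] := res1; have [/(_ x) [Sv vE] _] := res2.
move: (B1 x) (B2 x) uE Sv vE => u v uE Sv vE.
have domall f : dom N f by rewrite domN.
have := rinner_positive psN (domall (u - v)); have := rinner_ge0 (u - v).
have := leNS v Sv; rewrite -{1}vE -uE opB //.
rewrite !(rinnerBl, rinnerBr, rinnerDl, rinnerDr).
rewrite (rinner_symmetric psN (domall u) (domall v)).
(* Both sides are [<[v, x]>]. *)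
have : <[v, u]> + <[v, N u]> = <[v, v]> + <[v, S v]>.
  by rewrite -!rinnerDr uE vE.
rewrite !(rinnerC (N _)) (rinnerC (S _)) (rinnerC u v).
have -> : <[u, N v]> = <[v, N u]>.
  by rewrite -(rinner_symmetric psN) // rinnerC.
by lra.
Qed.

Lemma resolvent_symmetric S B x y : positive_symmetric S -> is_resolvent S B ->
  <[B x, y]> = <[x, B y]>.
Proof.
move=> psS [Bin _]; have [Sx xE] := Bin x; have [Sy yE] := Bin y.
rewrite -{1}yE -{2}xE rinnerDl rinnerDr; congr (_ + _).
by rewrite (rinner_symmetric psS).
Qed.

Lemma resolvent_inj S B B' : is_resolvent S B -> is_resolvent S B' -> B = B'.
Proof.
move=> [Bin _] [_ B'out]; apply/funext => x.
by have [Sx xE] := Bin x; rewrite -{2}xE B'out.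
Qed.

Lemma resolventD S B x y : is_resolvent S B -> B (x + y) = B x + B y.
Proof.
move=> [Bin Bout]; have [Sx xE] := Bin x; have [Sy yE] := Bin y.
by rewrite -{1}xE -{1}yE addrACA -opD // Bout //; exact: domD.
Qed.

(** Polarization: resolvents are additive and symmetric. *)
Lemma resolvent_form_inj S S' B B' :
    positive_symmetric S -> positive_symmetric S' ->
    is_resolvent S B -> is_resolvent S' B' ->
    (forall x, <[B x, x]> = <[B' x, x]>) -> B = B'.
Proof.
move=> psS psS' res res' form; apply/funext => x.
have polar y : <[B x, y]> = <[B' x, y]>.
  have := form (x + y); rewrite (resolventD _ _ res) (resolventD _ _ res').
  rewrite !(rinnerDl, rinnerDr) !form.
  rewrite (resolvent_symmetric y x psS res) (resolvent_symmetric y x psS' res').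
  by rewrite !(rinnerC y); lra.
by apply/subr0_eq/rinner_eq0; rewrite rinnerBl polar subrr.
Qed.

(** A resolvent determines its operator: [f = B (f + S f)] puts [f] in the domain of [S'], with
    [f + S' f = f + S f]. *)
Lemma resolvent_extends S S' B :
  is_resolvent S B -> is_resolvent S' B -> extends S' S.
Proof.
move=> [_ out] [into' _].
have SS' f : dom S f -> dom S' f /\ f + S' f = f + S f.
  by move=> Sf; have := into' (f + S f); rewrite out.
by split=> [f /SS'[]|f /SS'[_ /addrI]].
Qed.

(** Minimality used both ways gives equal resolvent forms, hence equal resolvents. This carries the
    bounds of the constructed extension over to any operator meeting the definition. *)
Lemma krein_von_neumann_unique T S S' :
  is_krein_von_neumann T S -> is_krein_von_neumann T S' -> extends S' S.
Proof.
move=> [psaS ST minS] [psaS' ST' minS'].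
have psS := positive_self_adjoint_symmetric psaS.
have psS' := positive_self_adjoint_symmetric psaS'.
have [B [B' [res res' le]]] := minS _ psaS' ST'.
have [C' [C [cres' cres le']]] := minS' _ psaS ST.
rewrite (resolvent_inj cres' res') (resolvent_inj cres res) in le'.
have BB' : B = B'.
  apply: (resolvent_form_inj psS psS' res res') => x.
  have := le x; have := le' x.
  rewrite (resolvent_inner x psS res) (resolvent_inner x psS' res') !ler_embed.
  by move=> le1 le2; apply/le_anti; rewrite le1.
by apply: (resolvent_extends res); rewrite BB'.
Qed.

End Resolvent.

(** * The three conditions and the norm bound *)

Section Main.
Context {R : realType} {k : scalar_kind} {H : hilbert_space R k}.
Implicit Types (T S N : operator H) (x y z f g h : H) (gamma M : R).

Lemma krein_extension_ex T gamma : positive_symmetric T -> 0 < gamma ->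
    (forall f, dom T f -> hnorm (T f) ^+ 2 <= gamma * <[T f, f]>) ->
  exists N, [/\ dom N = setT, is_krein_von_neumann T N &
    forall f, hnorm (N f) <= gamma * hnorm f].
Proof.
move=> psT gamma0 Tb; have [N [domN NP]] := krein_operator psT gamma0 Tb.
have psN : positive_symmetric N.
  apply: positive_symmetricP => [f g _ _|f _].
    exact: krein_graph_sym psT (NP f) (NP g).
  exact: krein_graph_ge0 psT (NP f).
have psaN := total_symmetric_self_adjoint domN psN.
have NT : extends N T.
  split=> [f _|f Tf]; first by rewrite domN.
  exact: (krein_graph_unique psT Tb (NP f) (krein_graph_extends Tf)).
exists N; split=> // [|f].
  split=> // S psaS ST; have psS := positive_self_adjoint_symmetric psaS.
  have [B1 res1] := resolvent_ex psaN; have [B2 res2] := resolvent_ex psaS.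
  exists B1, B2; split=> // x; apply: (resolvent_le x domN psN psS _ res1 res2).
  by move=> f Sf; exact: (krein_graph_le_extension psT psS ST (NP f) Sf).
have [-> |n0] := eqVneq (hnorm (N f)) 0.
  by rewrite mulr_ge0 ?hnorm_ge0 ?ltW.
have ngt0 : 0 < hnorm (N f) by rewrite lt_neqAle eq_sym n0 hnorm_ge0.
(* One factor [|N f|] cancels in [|N f|^2 <= gamma <[N f, f]> <= gamma |N f| |f|]. *)
rewrite -(ler_pM2l ngt0) -expr2.
apply: le_trans (krein_graph_bound psT Tb (NP f)) _.
rewrite mulrCA ler_pM2l //; exact: le_trans (ler_norm _) (CauchySchwarz _ _).
Qed.

(** Cauchy-Schwarz for the form of [S] at [f] and [g = S f]: [|g|^4 <= <[S f, f]> <[S g, g]> <=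
    <[S f, f]> gamma |g|^2]. *)
Lemma bounded_positive_square_bound S : bounded_positive_operator S ->
  exists2 gamma, 0 < gamma &
    forall f, hnorm (S f) ^+ 2 <= gamma * <[S f, f]>.
Proof.
move=> [domS [M SM] psaS]; have psS := positive_self_adjoint_symmetric psaS.
have dS f : dom S f by rewrite domS.
(* The bound [M] may be nonpositive, while [gamma] must be positive. *)
pose gamma := Num.max M 1.
have gamma0 : 0 < gamma by rewrite lt_max ltr01 orbT.
exists gamma => // f; pose g := S f.
have Sgg : <[S g, g]> <= gamma * <[g, g]>.
  apply: le_trans (ler_norm _) (le_trans (CauchySchwarz _ _) _).
  rewrite rinner_hnorm expr2 mulrA ler_wpM2r ?hnorm_ge0 //.
  apply: le_trans (SM g (dS g)) _; rewrite ler_wpM2r ?hnorm_ge0 //.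
  by rewrite le_max lexx.
have : <[g, g]> ^+ 2 <= <[S f, f]> * <[S g, g]>.
  apply: discriminant_le => [|t]; first exact: rinner_positive.
  have Sgf : <[S g, f]> = <[g, g]> by rewrite (rinner_symmetric psS) // rinnerC.
  have := rinner_positive psS (dS (f - embed t *: g)).
  rewrite opB // opZ // rinnerBl !rinnerBr !rinnerZl !rinnerZr Sgf -/g.
  by congr (_ <= _); ring.
rewrite -rinner_hnorm -/g => le_sq.
have [->|gg0] := eqVneq <[g, g]> 0.
  by rewrite mulr_ge0 ?(ltW gamma0) // (rinner_positive psS).
have gggt0 : 0 < <[g, g]> by rewrite lt_neqAle eq_sym gg0 rinner_ge0.
rewrite -(ler_pM2r gggt0) -expr2; apply: le_trans le_sq _.
by rewrite [leRHS]mulrAC mulrC ler_wpM2r // (rinner_positive psS).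
Qed.

Lemma inner_form_le1 T h : positive_symmetric T -> dom T h ->
  (inner H (T h) h <= 1) = (<[T h, h]> <= 1).
Proof.
move=> [_ pos] Th.
by rewrite (ge0_embed (pos h Th)) -(embed1 (R := R)) ler_embed.
Qed.

Lemma D_star_pointwise T g : positive_symmetric T -> D_star T g ->
  exists M, forall h, dom T h -> <[T h, h]> <= 1 -> `|<[g, T h]>| <= M.
Proof.
move=> psT; rewrite /D_star /=; set E := [set _ | _ in _] => supE.
have E_le h : dom T h -> <[T h, h]> <= 1 ->
    ((re_scalar `|inner H (T h) g| ^+ 2)%:E <= ereal_sup E)%E.
  move=> Th le1; apply: ereal_sup_ubound; exists h => //=.
  by rewrite inner_form_le1.
(* The value [+oo] is excluded by hypothesis, and [-oo] is refuted by any admissible [h]. *)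
case: (ereal_sup E) supE E_le => [r| |] // _ E_le; last first.
  by exists 0 => h Th /(E_le _ Th).
(* The inequality [t <= t^2 + 1] spares a square root of [r]. *)
exists (r + 1) => h Th /(E_le _ Th); rewrite lee_fin rinnerC => le_r.
apply: (le_trans (normr_re _)).
have := sqr_ge0 (re_scalar `|inner H (T h) g| - 1).
by have := sqr_ge0 (re_scalar `|inner H (T h) g|); lra.
Qed.

(** Uniform boundedness bounds [T] by some [M] on the unit ball of its form; scaling [f] into that
    ball gives [|T f|^2 <= M^2 <[T f, f]>]. *)
Lemma D_star_square_bound T : positive_symmetric T -> D_star T = setT ->
  exists2 gamma, 0 < gamma &
    forall f, dom T f -> hnorm (T f) ^+ 2 <= gamma * <[T f, f]>.
Proof.
move=> psT DT.
have [g|M MP] := @uniform_boundedness _ _ _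
  [set T h | h in [set h | dom T h /\ <[T h, h]> <= 1]].
  have [|M MP] := @D_star_pointwise T g psT; first by rewrite DT.
  by exists M => _ [h [Th le1] <-]; exact: MP.
exists (M ^+ 2 + 1) => [|f Tf]; first by rewrite ltr_wpDl ?sqr_ge0.
have scaled t : 0 <= t -> t ^+ 2 * <[T f, f]> <= 1 -> t * hnorm (T f) <= M.
  move=> t0 le1; rewrite -hnormZ_embed // -opZ //; apply: MP.
  exists (embed t *: f) => //; split; first exact: domZ.
  by rewrite opZ // rinnerZl rinnerZr mulrA -expr2.
have [s0|sn0] := eqVneq <[T f, f]> 0.
  have [->|n0] := eqVneq (hnorm (T f)) 0; first by rewrite s0 mulr0 expr0n.
  have ngt0 : 0 < hnorm (T f) by rewrite lt_neqAle eq_sym n0 hnorm_ge0.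
  (* Where the form vanishes, all multiples of [f] lie in the ball; this one would give
     [|M| + 1 <= M]. *)
  have := scaled ((`|M| + 1) / hnorm (T f)); rewrite s0 mulr0 divfK //.
  rewrite divr_ge0 ?addr_ge0 ?hnorm_ge0 // ler01 => /(_ isT isT).
  by have := ler_norm M; lra.
have s_gt0 : 0 < <[T f, f]>.
  by rewrite lt_neqAle eq_sym sn0 (rinner_positive psT).
have M0 : 0 <= M.
  by have := scaled 0; rewrite expr0n !mul0r; apply.
have := scaled (Num.sqrt <[T f, f]>)^-1; rewrite invr_ge0 sqrtr_ge0.
rewrite exprVn sqr_sqrtr ?(ltW s_gt0) // mulVf // lexx => /(_ isT isT).
rewrite mulrC ler_pdivrMr ?sqrtr_gt0 // => le_M.
have : hnorm (T f) ^+ 2 <= (M * Num.sqrt <[T f, f]>) ^+ 2.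
  by rewrite ler_sqr ?nnegrE ?hnorm_ge0 // mulr_ge0 ?sqrtr_ge0.
by rewrite exprMn sqr_sqrtr ?(ltW s_gt0) //; lra.
Qed.

Lemma square_bound_D_star T gamma : positive_symmetric T -> 0 < gamma ->
  (forall f, dom T f -> hnorm (T f) ^+ 2 <= gamma * <[T f, f]>) ->
  D_star T = setT.
Proof.
move=> psT gamma0 Tb; apply/seteqP; split=> // g _; rewrite /D_star /=.
apply: (@le_lt_trans _ _ (gamma * hnorm g ^+ 2)%:E); last exact: ltry.
apply: ge_ereal_sup => _ [h [Th le1] <-]; rewrite lee_fin.
have : re_scalar `|inner H (T h) g| ^+ 2 <= (hnorm (T h) * hnorm g) ^+ 2.
  rewrite ler_sqr ?nnegrE ?re_norm_ge0 ?mulr_ge0 ?hnorm_ge0 //.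
  exact: CauchySchwarz_scalar.
move/le_trans; apply; rewrite exprMn ler_wpM2r ?sqr_ge0 //.
apply: le_trans (Tb h Th) _; rewrite -[leRHS]mulr1 ler_pM2l //.
by rewrite -inner_form_le1.
Qed.

Lemma op_norm_le S gamma : dom S = setT -> 0 <= gamma ->
  (forall f, hnorm (S f) <= gamma * hnorm f) -> op_norm S <= gamma.
Proof.
move=> domS gamma0 Sb; apply: ge_sup.
  by exists (hnorm (S 0)), 0 => //=; rewrite domS hnorm0 ler01.
move=> _ [f [_ f1] <-]; apply: le_trans (Sb f) _.
by rewrite -[leRHS]mulr1 ler_wpM2l.
Qed.

End Main.

Unset Implicit Arguments.

Theorem theorem7p1 (R : realType) (k : scalar_kind) (H : hilbert_space R k)
    (T : operator H) (T_pos_sym : positive_symmetric T) :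
  [/\ (exists2 S : operator H, bounded_positive_operator S & extends S T)
        <-> D_star T = setT,
      D_star T = setT
        <-> (exists2 gamma : R, 0 < gamma &
              forall f, dom T f ->
                hnorm (T f) ^+ 2 <= gamma * re_scalar (inner H (T f) f))
    & forall gamma : R, 0 < gamma ->
        (forall f, dom T f ->
           hnorm (T f) ^+ 2 <= gamma * re_scalar (inner H (T f) f)) ->
        (exists TN : operator H, is_krein_von_neumann T TN) /\
        (forall TN : operator H, is_krein_von_neumann T TN ->
           [/\ dom TN = setT, bounded_op TN & op_norm TN <= gamma])].
Proof.
split.
- split=> [[S bS [TS ST]]|/(D_star_square_bound T_pos_sym)[gamma gamma0 Tb]].
    (* From (i) to (ii) through (iii), which [T] inherits from [S]. *)
    have [gamma gamma0 Sb] := bounded_positive_square_bound bS.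
    by apply: (square_bound_D_star T_pos_sym gamma0) => f Tf; rewrite -ST.
  have [N [domN [psaN NT _] Nb]] := krein_extension_ex T_pos_sym gamma0 Tb.
  by exists N => //; split=> //; exists gamma => f _; exact: Nb.
- split=> [/(D_star_square_bound T_pos_sym)//|[gamma gamma0 Tb]].
  exact: (square_bound_D_star T_pos_sym gamma0 Tb).
move=> gamma gamma0 Tb.
have [N [domN kN Nb]] := krein_extension_ex T_pos_sym gamma0 Tb.
split=> [|TN kTN]; first by exists N.
(* Since [N] is everywhere defined, any [TN] extending it has the same domain and values, hence the
   same bound. *)
have [sub NE] := krein_von_neumann_unique kN kTN.
have domTN : dom TN = setT.
  by apply/seteqP; split=> // x _; apply: sub; rewrite domN.
have TNb f : hnorm (TN f) <= gamma * hnorm f by rewrite NE ?domN.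
split=> //; first by exists gamma => f _; exact: TNb.
by apply: op_norm_le => //; exact: ltW.
Qed.
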